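(* Let $M>m>0$ be real numbers, let $\mathcal{H}$ be a complex Hilbert space and let $A\in\mathcal{B}(\mathcal{H})$. (i) If $C_{M,m}(A)$ is accretive, then $|A|^2\le \left(\frac{M+m}{2\sqrt{Mm}}\right)^2(\mathfrak{R}A)^2$. (ii) If $C_{M,m}(\mathrm{i}A^* )$ is accretive, then $|A^*|^2\le \left(\frac{M+m}{2\sqrt{Mm}}\right)^2(\mathfrak{I}A)^2$. (iii) If $A$ is invertible and $C_{M,m}(A^{-1})$ is accretive, then $|A^{-1}|^2\le \left(\frac{M+m}{2\sqrt{Mm}}\right)^2(\mathfrak{R}A^{-1})^2$.
   Context: $\mathcal{B}(\mathcal{H})$ is the algebra of bounded linear operators on $\mathcal{H}$, with identity $I$. $C_{M,m}(T)=(MI-T^* )(T-mI)$; $|T|=(T^*T)^{1/2}$; $\mathfrak{R}T=\frac{T+T^*}{2}$ and $\mathfrak{I}T=\frac{T-T^*}{2\mathrm{i}}$. $T$ is accretive if $\mathfrak{R}T\ge 0$ (positive semi-definite). For self-adjoint $S,T$, $S\le T$ means $T-S$ is positive semi-definite. *)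

(* Defs.v *)
From HB Require Import structures.
From mathcomp Require Import all_boot all_order all_algebra.
From mathcomp Require Import complex.
From mathcomp Require Import boolp classical_sets functions reals.
From mathcomp Require Import topology normedtype.

Set Implicit Arguments.
Unset Strict Implicit.
Unset Printing Implicit Defensive.

Import Order.TTheory GRing.Theory Num.Theory.
Import numFieldNormedType.Exports.

Local Open Scope ring_scope.
Local Open Scope complex_scope.
Local Open Scope classical_set_scope.

(* The inner product is linear in its first argument, conjugate-linear in the
   second one. *)
HB.mixin Record CompleteNormedModule_isHilbert (R : realType) H
    & CompleteNormedModule R[i] H := {
  inner : {dot H for @Num.conj R[i]} ;
  normr_inner : forall x : H, `|x| ^+ 2 = inner x x
}.

#[short(type="hilbertType")]
HB.structure Definition Hilbert (R : realType) :=
  {H of CompleteNormedModule R[i] H & CompleteNormedModule_isHilbert R H}.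

Section BoundedOperators.
Context {R : realType} {H : hilbertType R}.

Definition bounded_op : {pred H -> H} :=
  [pred f | `[< linear f /\
                exists k : R, forall x, `|f x| <= k%:C * `|x| >]].

Record boundedOp := BoundedOp
  { bop_fun :> H -> H ; bop_fun_subproof : bop_fun \in bounded_op }.

HB.instance Definition _ := [isSub for bop_fun].
HB.instance Definition _ := [Choice of boundedOp by <:].

Lemma bopP (A B : boundedOp) : A =1 B -> A = B.
Proof. by move=> AB; apply/val_inj/funext. Qed.

Lemma bop_linear (A : boundedOp) : linear A.
Proof. by case: A => f /= /asboolP[]. Qed.

HB.instance Definition _ (A : boundedOp) :=
  GRing.isLinear.Build R[i] H H *:%R A (bop_linear A).

Lemma bop_bounded (A : boundedOp) :
  exists2 k : R, 0 <= k & forall x, `|A x| <= k%:C * `|x|.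
Proof.
case: A => f /= /asboolP[_ [k fk]]; exists `|k| => // x.
by rewrite (le_trans (fk x))// ler_wpM2r// lecR ler_norm.
Qed.

Lemma bounded_op_submod : submod_closed bounded_op.
Proof.
split.
  apply/asboolP; split=> [a u v|]; first by rewrite scaler0 addr0.
  by exists 0 => x; rewrite normr0 mul0r.
move=> a f g /asboolP[lf [k fk]] /asboolP[lg [l gl]]; apply/asboolP; split.
  move=> b u v; rewrite !fctE lf lg !scalerDr addrACA; congr (_ + _ + _).
  by rewrite !scalerA mulrC.
have [r ar] : exists r : R, `|a| = r%:C.
  by exists (complex.Re `|a|); rewrite RRe_real// ger0_real.
exists (r * k + l) => x; rewrite !fctE (le_trans (ler_normD _ _))// normrZ ar.
by rewrite rmorphD rmorphM mulrDl -mulrA lerD// ler_wpM2l// -ar.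
Qed.

HB.instance Definition _ :=
  GRing.isSubmodClosed.Build _ _ bounded_op bounded_op_submod.
HB.instance Definition _ := [SubChoice_isSubLmodule of boundedOp by <:].

Lemma bounded_op_id : (idfun : H -> H) \in bounded_op.
Proof. by apply/asboolP; split=> //; exists 1 => x; rewrite mul1r. Qed.

Lemma bounded_op_comp (A B : boundedOp) : A \o B \in bounded_op.
Proof.
apply/asboolP; split=> [a u v|]; first by rewrite /= !linearP.
have [k k0 Ak] := bop_bounded A; have [l l0 Bl] := bop_bounded B.
exists (k * l) => x /=; rewrite (le_trans (Ak _))//.
by rewrite rmorphM/= -mulrA ler_wpM2l// lecR.
Qed.

Let bop1 := BoundedOp bounded_op_id.
Let bopM (A B : boundedOp) := BoundedOp (bounded_op_comp A B).

Let bopMA : associative bopM. Proof. by move=> A B C; exact: bopP. Qed.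
Let bop1M : left_id bop1 bopM. Proof. by move=> A; exact: bopP. Qed.
Let bopM1 : right_id bop1 bopM. Proof. by move=> A; exact: bopP. Qed.
Let bopMDl : left_distributive bopM +%R.
Proof. by move=> A B C; exact: bopP. Qed.
Let bopMDr : right_distributive bopM +%R.
Proof. by move=> A B C; apply: bopP => x /=; rewrite raddfD. Qed.

(* 1 = 0 when H is trivial, so that only a [pzRingType] is available; in
   particular [algType], which requires 1 != 0, is not. *)
HB.instance Definition _ :=
  GRing.Zmodule_isPzRing.Build boundedOp bopMA bop1M bopM1 bopMDl bopMDr.

Lemma bop_scalerAl (a : R[i]) (A B : boundedOp) : a *: (A * B) = a *: A * B.
Proof. exact: bopP. Qed.

Lemma bop_scalerAr (a : R[i]) (A B : boundedOp) : a *: (A * B) = A * (a *: B).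
Proof. by apply: bopP => x /=; rewrite linearZ. Qed.

End BoundedOperators.

Arguments boundedOp {R} H.
Notation "''B(' H )" := (boundedOp H) (format "''B(' H )") : type_scope.

Section Operators.
Context {R : realType} {H : hilbertType R}.
Implicit Types S T : 'B(H).

(* The operator characterized below is unique, and it exists by the Riesz
   representation theorem. *)
Definition adjoint T : 'B(H) :=
  xget 0 [set S : 'B(H) | forall x y, inner (T x) y = inner x (S y)].

(* [0 <= z] on complex numbers means that z is real and nonnegative, so that
   the quadratic form is real-valued and T is self-adjoint. *)
Definition psd T := forall x, 0 <= inner (T x) x.

Definition ople S T := psd (T - S).

(* The positive square root; it exists and is unique when T is psd. *)
Definition opsqrt T : 'B(H) := xget 0 [set S : 'B(H) | psd S /\ S * S = T].

Definition opabs T : 'B(H) := opsqrt (adjoint T * T).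

Definition opRe T : 'B(H) := 2^-1 *: (T + adjoint T).

Definition opIm T : 'B(H) := (2 * 'i)^-1 *: (T - adjoint T).

Definition accretive T := psd (opRe T).

Definition opC (M m : R) T : 'B(H) :=
  (M%:C *: (1 : 'B(H)) - adjoint T) * (T - m%:C *: (1 : 'B(H))).

Definition op_inverse T S := T * S = 1 /\ S * T = 1.

Definition op_invertible T := exists S, op_inverse T S.

Definition opinv T : 'B(H) := xget 0 [set S : 'B(H) | op_inverse T S].

End Operators.

Notation "T ^*o" := (adjoint T) (at level 2, format "T ^*o") : ring_scope.
Notation "S <=o T" := (ople S T) (at level 70, no associativity) : ring_scope.

(* Main.v *)
From HB Require Import structures.
Require Import Defs.
From mathcomp Require Import all_boot all_order all_algebra.
From mathcomp Require Import complex reals boolp classical_sets filter topology.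
From mathcomp Require Import normedtype.
From mathcomp Require Import ring.

Set Implicit Arguments.
Unset Strict Implicit.
Unset Printing Implicit Defensive.

Import Order.TTheory GRing.Theory Num.Theory.
Import numFieldNormedType.Exports.
Local Open Scope ring_scope.
Local Open Scope complex_scope.

(** Put T = A, T = i A^* or T = A^{-1}, and let R be the real part of T. The
real part of C_{M,m}(T) is (M + m) R - Mm I - T^* T, so accretivity says

  |T x|^2 <= (M + m) <R x, x> - Mm |x|^2   for all x.

Completing the square finishes the proof: with b = sqrt (Mm) and
a = (M + m) / (2 b), expanding 0 <= |a R x - b x|^2 gives
(M + m) <R x, x> - Mm |x|^2 <= a^2 |R x|^2, because 2 a b = M + m and R is
symmetric. This is [opabs_sqr_ople]. The second claim is the first one for
i A^*, whose real part is the imaginary part of A and whose modulus is that of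
A^* ([opRe_iadjoint], [opabs_iadjoint]).

The computation uses the adjoint through the identity <T x, y> = <x, T^* y>,
so that every bounded operator must be shown to have an adjoint
([adjoint_exists]). This rests on the Riesz representation theorem ([riesz]),
obtained variationally: the vector representing f is the minimizer of
|x|^2 - 2 Re (f x). If x minimizes this functional up to d, then testing
against x + c v for a well-chosen scalar c shows that
|<v, x> - f v| <= sqrt d |v| for all v ([near_minimizer]). Hence near
minimizers form a Cauchy filter, and its limit represents f. The same estimate
with f = 0 is the Cauchy-Schwarz inequality. *)

Section HilbertSpace.
Context {R : realType} {H : hilbertType R}.
Implicit Types (x y v : H) (f : {linear H -> R[i]^o}).

Lemma innerC x y : inner x y = Num.conj (inner y x).
Proof. by rewrite hermC expr0 mul1r. Qed.

Lemma inner_extr x y : (forall v, inner v x = inner v y) -> x = y.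
Proof.
move=> xy; apply/eqP; rewrite -subr_eq0 -(@dnorm_eq0 _ _ inner).
by rewrite linearBr /= xy subrr.
Qed.

(** * Riesz representation *)

Definition energy f x : R[i] := `|x| ^+ 2 - (f x + Num.conj (f x)).

Lemma energyD f x v : energy f (x + v) =
  energy f x + `|v| ^+ 2 + (inner v x - f v + Num.conj (inner v x - f v)).
Proof.
rewrite /energy !normr_inner dnormD /= linearD /= !rmorphD rmorphN /= (innerC x v).
by rewrite Num.Theory.conjCK; ring.
Qed.

(** The best perturbation of x in the direction v lowers the energy by
|g|^2 / |v|^2, where g = <v, x> - f v; for a minimizer up to d this gain is at
most d. *)
Lemma near_minimizer f (d : R[i]) x v :
  (forall y, energy f x - d <= energy f y) ->
  `|inner v x - f v| ^+ 2 <= d * `|v| ^+ 2.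
Proof.
move=> xmin; have [->|v0] := eqVneq v 0.
  by rewrite linear0l linear0 subrr !normr0 expr0n mulr0.
have n0 : 0 < `|v| ^+ 2 by rewrite exprn_gt0// normr_gt0.
set g := inner v x - f v; set n := `|v| ^+ 2 in n0 *.
(* This c minimizes the energy of x + c v. *)
pose c := - (n^-1 * Num.conj g).
have gE : inner (c *: v) x - f (c *: v) = c * g.
  by rewrite linearZl_LR (linearZ_LR f) -mulrBr.
have := xmin (x + c *: v); rewrite energyD gE normrZ exprMn -/n.
have -> : `|c| ^+ 2 * n = n^-1 * `|g| ^+ 2.
  rewrite normrN normrM normfV (gtr0_norm n0) norm_conjC exprMn.
  by rewrite mulrAC expr2 mulfVK ?gt_eqF// mulrC.
have -> : c * g = - (n^-1 * `|g| ^+ 2) by rewrite normCK mulNr -mulrA (mulrC g).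
rewrite rmorphN/= geC0_conj; last by rewrite mulr_ge0 ?exprn_ge0// invr_ge0 ltW.
rewrite [leRHS]addrA addrK lerD2l lerN2.
by rewrite mulrC ler_pdivrMr.
Qed.

(** The energy of f = 0 is the squared norm, which every x minimizes up to its
own squared norm, so that [near_minimizer] applies with d = |x|^2. *)
Lemma CauchySchwarz_inner x v : `|inner v x| <= `|v| * `|x|.
Proof.
rewrite -ler_sqr ?nnegrE ?mulr_ge0// exprMn mulrC.
have := @near_minimizer \0 (`|x| ^+ 2) x v; rewrite /= subr0; apply => y.
by rewrite /energy /= !rmorph0 !addr0 !subr0 subrr exprn_ge0.
Qed.

Lemma energy_real f x : energy f x \is Num.real.
Proof.
by rewrite rpredB ?rpredX ?normr_real// CrealE rmorphD/= Num.Theory.conjCK addrC.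
Qed.

(** Since Re (f x) <= k |x|, the energy is at least (|x| - k)^2 - k^2. *)
Lemma energy_ge f (k : R[i]) : (forall x, `|f x| <= k * `|x|) ->
  k \is Num.real -> forall x, - k ^+ 2 <= energy f x.
Proof.
move=> fk kR x; rewrite /energy.
have le2 : f x + Num.conj (f x) <= 2 * (k * `|x|).
  apply: le_trans (real_ler_norm _) _.
    by rewrite CrealE rmorphD/= Num.Theory.conjCK addrC.
  rewrite (le_trans (ler_normD _ _))// norm_conjC -mulr2n -[leLHS]mulr_natl.
  by rewrite ler_wpM2l.
have sq : 0 <= (`|x| - k) ^+ 2 by rewrite real_exprn_even_ge0// rpredB// normr_real.
rewrite lerBrDr (le_trans (lerD (lexx _) le2))// -subr_ge0.
rewrite (_ : _ - _ = (`|x| - k) ^+ 2)//; ring.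
Qed.

Section Riesz.
Variables (f : {linear H -> R[i]^o}) (k : R).
Hypothesis fk : forall x, `|f x| <= k%:C * `|x|.

Let near_rep (e : R[i]) : set H :=
  [set x | forall v, `|inner v x - f v| <= e * `|v|].

Lemma near_rep_nonempty (e : R[i]) : 0 < e -> exists x, near_rep e x.
Proof.
move=> e0; pose E := range (fun x => complex.Re (energy f x)).
have ReK x : (complex.Re (energy f x))%:C = energy f x.
  by rewrite RRe_real// energy_real.
have Elb : has_inf E.
  split; first by exists (complex.Re (energy f 0)), 0.
  exists (- k ^+ 2) => _ [x _ <-]; rewrite -lecR ReK rmorphN rmorphXn.
  by apply: (energy_ge fk); rewrite complex_real.
have eE : (complex.Re e)%:C = e by rewrite RRe_real// gtr0_real.
have d0 : 0 < complex.Re e ^+ 2 by rewrite exprn_gt0// -ltcR eE.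
have [_ [x _ <-] xE] := inf_adherent d0 Elb.
exists x => v; rewrite -ler_sqr ?nnegrE ?mulr_ge0 ?(ltW e0)// exprMn.
apply: near_minimizer => y.
rewrite -(ReK x) -(ReK y) -eE -rmorphXn -rmorphB lecR lerBlDr (le_trans (ltW xE))// lerD2r.
by apply: ge_inf; [case: Elb|exists y].
Qed.

(** Two vectors representing f up to d and e are at distance at most d + e, as
one sees by testing their difference against itself; so the sets of near
representatives generate a Cauchy filter. *)
Lemma riesz : exists z, forall v, f v = inner v z.
Proof.
pose F := filter_from [set e : R[i] | 0 < e] near_rep.
have FF : ProperFilter F.
  apply: filter_from_proper => [|e /near_rep_nonempty//].
  apply: filter_from_filter; first by exists 1; exact: ltr01.
  move=> d e d0 e0.
  have [le|le] := orP (real_leVge (gtr0_real d0) (gtr0_real e0)).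
    by exists d => // x xd; split=> // v; rewrite (le_trans (xd v))// ler_wpM2r.
  by exists e => // x xe; split=> // v; rewrite (le_trans (xe v))// ler_wpM2r.
have Fc : cauchy F.
  apply: cauchy_exP => e e0; have e3 : 0 < e / 3 by rewrite divr_gt0.
  have [x xe] := near_rep_nonempty e3; exists x; exists (e / 3) => // y ye.
  rewrite -ball_normE /=.
  set v := x - y; have [->|v0] := eqVneq v 0; first by rewrite normr0.
  have n0 : 0 < `|v| by rewrite normr_gt0.
  rewrite -(ltr_pM2r n0) -expr2 normr_inner.
  have vE : inner v v = (inner v x - f v) - (inner v y - f v).
    by rewrite {2}/v linearBr /=; ring.
  rewrite -(ger0_norm (dnorm_ge0 inner v)) vE.
  rewrite (le_lt_trans (ler_normB _ _))// (le_lt_trans (lerD (xe v) (ye v)))//.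
  rewrite -mulrDl ltr_pM2r// -mulrDr gtr_pMr//.
  by rewrite -mulr2n -[_ *+ 2]mulr_natl ltr_pdivrMr// mul1r ltr_nat.
have /cvg_ex[z Fz] : cvg F by exact: cauchy_cvg.
exists z => v; apply/eqP; rewrite eq_sym -subr_eq0; apply/negP => /negP g0.
have n0 : 0 < `|v| + 1 by rewrite ltr_wpDl.
(* Near z there is a representative up to e; together with the distance e to z
   this bounds the defect at v by 2 e |v|, which is less than the defect. The 1
   in the denominator covers v = 0. *)
pose e := `|inner v z - f v| / 2 / (`|v| + 1).
have e0 : 0 < e by rewrite !divr_gt0// normr_gt0.
have Fe : F (near_rep e) by exists e.
have [y [ye zy]] := filter_ex (filterI Fe (Fz _ (nbhsx_ballx z e e0))).
rewrite -ball_normE /= in zy.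
suff : `|inner v z - f v| < `|inner v z - f v| by rewrite ltxx.
apply: (@le_lt_trans _ _ (e * 2 * `|v|)); last first.
  have -> : e * 2 = `|inner v z - f v| / (`|v| + 1) by rewrite /e mulrAC divfK ?pnatr_eq0.
  rewrite mulrAC ltr_pdivrMr// ltr_pM2l ?normr_gt0//.
  by rewrite ltrDl.
rewrite (_ : _ - _ = inner v (z - y) + (inner v y - f v)); last first.
  by rewrite linearBr /=; ring.
rewrite (le_trans (ler_normD _ _))// mulr2n mulrDr mulr1 mulrDl lerD//.
rewrite (le_trans (CauchySchwarz_inner _ _))// mulrC ler_wpM2r//.
exact: ltW.
Qed.

End Riesz.

(** * Adjoints *)

(** S y represents the functional x |-> <T x, y>. Linearity of S is uniqueness
of the representative, and |S y|^2 = <T (S y), y> <= k |S y| |y| bounds it. *)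
Lemma adjoint_exists (T : 'B(H)) :
  exists S : 'B(H), forall x y, inner (T x) y = inner x (S y).
Proof.
have [k k0 Tk] := bop_bounded T.
have /choice[S TS] y : exists z, forall x, inner (T x) y = inner x z.
  have lf : linear (fun x => inner (T x) y : R[i]^o).
    by move=> a u v; rewrite linearP linearPl.
  pose f : {linear H -> R[i]^o} :=
    HB.pack (fun x => inner (T x) y : R[i]^o) (GRing.isLinear.Build _ _ _ _ _ lf).
  apply: (@riesz f (k * complex.Re `|y|)) => x.
  rewrite rmorphM /= RRe_real ?normr_real// mulrAC.
  by rewrite (le_trans (CauchySchwarz_inner _ _))// ler_wpM2r.
have Sb : S \in bounded_op.
  apply/asboolP; split=> [a u v|].
    apply: inner_extr => w; rewrite -TS !linearPr /=.
    by rewrite !TS.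
  exists k => y; have [->|Sy0] := eqVneq (S y) 0.
    by rewrite normr0 mulr_ge0// lecR.
  rewrite -(@ler_pM2l _ `|S y|) ?normr_gt0// -expr2 normr_inner -TS.
  apply: le_trans (real_ler_norm _) _.
    by rewrite TS -normr_inner rpredX ?normr_real.
  rewrite (le_trans (CauchySchwarz_inner _ _))// mulrA ler_wpM2r//.
  by rewrite mulrC Tk.
by exists (BoundedOp Sb) => x y /=.
Qed.

Lemma adjointP (T : 'B(H)) x y : inner (T x) y = inner x (T^*o y).
Proof. by apply: (xgetPex 0 (adjoint_exists T)). Qed.

Lemma adjointPr (T : 'B(H)) x y : inner (T^*o x) y = inner x (T y).
Proof. by rewrite innerC -adjointP -innerC. Qed.

Lemma adjoint_unique (S T : 'B(H)) :
  (forall x y, inner (T x) y = inner x (S y)) -> T^*o = S.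
Proof.
by move=> TS; apply: bopP => y; apply: inner_extr => x; rewrite -adjointP.
Qed.

Lemma adjointK (T : 'B(H)) : T^*o^*o = T.
Proof. by apply: adjoint_unique => x y; rewrite adjointPr. Qed.

Lemma adjointZ (a : R[i]) (T : 'B(H)) : (a *: T)^*o = Num.conj a *: T^*o.
Proof.
apply: adjoint_unique => x y; rewrite linearZl_LR /= linearZr_LR /=.
by rewrite adjointP Num.Theory.conjCK.
Qed.

(** * Real part, modulus and the operator inequality *)

Lemma inner_opRe (T : 'B(H)) x :
  inner (opRe T x) x = (inner (T x) x + Num.conj (inner (T x) x)) / 2.
Proof. by rewrite linearZl_LR linearDl /= adjointPr -innerC mulrC. Qed.

Lemma opRe_symmetric (T : 'B(H)) x y : inner (opRe T x) y = inner x (opRe T y).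
Proof.
rewrite linearZl_LR linearZr_LR linearDl linearDr /= adjointP adjointPr.
by rewrite fmorphV /= conjC_nat addrC.
Qed.

(** The modulus is by definition either a square root of T^* T, and then
equality holds, or the default value 0, and then the left side vanishes. *)
Lemma opabs_sqr_le (T : 'B(H)) x : inner ((opabs T ^+ 2) x) x <= `|T x| ^+ 2.
Proof.
rewrite /opabs /opsqrt expr2; case: xgetP => [S _ [_ ->]|_].
  by rewrite /= adjointPr -normr_inner.
by rewrite mul0r linear0l exprn_ge0.
Qed.

(** Expanding, <C x, x> = M <T x, x> + m <x, T x> - Mm |x|^2 - |T x|^2; the
claim is the nonnegativity of its real part. *)
Lemma accretive_opC_le (M m : R) (T : 'B(H)) : accretive (opC M m T) ->
  forall x, `|T x| ^+ 2 <=
    (M + m)%:C * inner (opRe T x) x - (M * m)%:C * `|x| ^+ 2.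
Proof.
move=> acc x; have := acc x; rewrite !inner_opRe.
have -> : inner (opC M m T x) x = M%:C * inner (T x) x - (M * m)%:C * `|x| ^+ 2
    - `|T x| ^+ 2 + m%:C * Num.conj (inner (T x) x).
  rewrite -[LHS]/(inner (M%:C *: (T x - m%:C *: x) - T^*o (T x - m%:C *: x)) x).
  rewrite linearBl /= linearZl_LR adjointPr !linearBl /= !linearZl_LR /=.
  by rewrite (innerC x (T x)) -!normr_inner rmorphM /=; ring.
have realJ (z : R[i]) : z \is Num.real -> Num.conj z = z by exact: conj_Creal.
rewrite !(rmorphD, rmorphB, rmorphM, rmorphN) /= Num.Theory.conjCK.
rewrite !(realJ _%:C) ?complex_real// !(realJ `|_|) ?normr_real//.
move=> h; rewrite -subr_ge0; move: h.
set l := (X in 0 <= X -> _); set r := (X in _ -> 0 <= X).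
suff -> : r = l by [].
by rewrite /l /r; field.
Qed.

Lemma opleP (S T : 'B(H)) :
  S <=o T <-> forall x, inner (S x) x <= inner (T x) x.
Proof.
have TS x : inner ((T - S) x) x = inner (T x) x - inner (S x) x.
  by rewrite -linearBl.
by split=> le x; move: (le x); rewrite -subr_ge0 -TS.
Qed.

(** The difference between the bound of [accretive_opC_le] and the right side is
the square |a R x - b x|^2, with b = sqrt (Mm) and 2 a b = M + m. *)
Lemma opabs_sqr_ople (M m : R) (T : 'B(H)) : 0 < M * m -> accretive (opC M m T) ->
  opabs T ^+ 2 <=o
    (((M + m) / (2 * Num.sqrt (M * m))) ^+ 2)%:C *: opRe T ^+ 2.
Proof.
move=> Mm0 acc; apply/opleP => x; set a := (M + m) / _; set b := Num.sqrt (M * m) in a *.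
have sqrE (c : R[i]) (S : 'B(H)) : inner ((c *: S ^+ 2) x) x = c * inner (S (S x)) x.
  by rewrite expr2 -linearZl_LR.
rewrite sqrE opRe_symmetric -normr_inner.
apply: le_trans (opabs_sqr_le T x) (le_trans (accretive_opC_le acc x) _).
have b0 : 0 < b by rewrite sqrtr_gt0.
have -> : M * m = b ^+ 2 by rewrite sqr_sqrtr// ltW.
have -> : M + m = 2 * a * b by rewrite /a; field; rewrite gt_eqF.
move: (opRe T x) (opRe_symmetric T x x) => r rx.
rewrite -subr_ge0 (_ : _ - _ = `|a%:C *: r - b%:C *: x| ^+ 2) ?exprn_ge0//.
have realJ (z : R) : Num.conj (z%:C) = z%:C by rewrite conj_Creal// complex_real.
rewrite !normr_inner linearBl /= !linearBr /= !linearZl_LR !linearZr_LR /= !realJ.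
rewrite -rx !rmorphM /=.
by ring.
Qed.

Lemma adjoint_iadjoint (T : 'B(H)) : ('i *: T^*o)^*o = - 'i *: T.
Proof. by rewrite adjointZ adjointK conjCi. Qed.

Lemma opRe_iadjoint (T : 'B(H)) : opRe ('i *: T^*o) = opIm T.
Proof.
rewrite /opRe /opIm adjoint_iadjoint invfM invCi -scalerA; congr (_ *: _).
by rewrite scalerBr !scaleNr opprK addrC.
Qed.

Lemma opabs_iadjoint (T : 'B(H)) : opabs ('i *: T^*o) = opabs T^*o.
Proof.
rewrite /opabs adjoint_iadjoint adjointK; congr opsqrt.
by rewrite -bop_scalerAl -bop_scalerAr scalerA mulNr -expr2 sqrCi opprK scale1r.
Qed.

End HilbertSpace.

Theorem theorem2p4 (R : realType) (M m : R) (m_gt0 : 0 < m) (m_lt_M : m < M)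
    (H : hilbertType R) (A : 'B(H)) :
  [/\ accretive (opC M m A) ->
      opabs A ^+ 2 <=o
        (((M + m) / (2 * Num.sqrt (M * m))) ^+ 2)%:C *: opRe A ^+ 2,
      accretive (opC M m ('i *: A^*o)) ->
      opabs (A^*o) ^+ 2 <=o
        (((M + m) / (2 * Num.sqrt (M * m))) ^+ 2)%:C *: opIm A ^+ 2
    & op_invertible A -> accretive (opC M m (opinv A)) ->
      opabs (opinv A) ^+ 2 <=o
        (((M + m) / (2 * Num.sqrt (M * m))) ^+ 2)%:C *: opRe (opinv A) ^+ 2].
Proof.
have Mm0 : 0 < M * m by rewrite mulr_gt0// (lt_trans m_gt0).
split=> [|acc|_]; [exact: opabs_sqr_ople| |exact: opabs_sqr_ople].
rewrite -opRe_iadjoint -opabs_iadjoint; exact: opabs_sqr_ople.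
Qed.
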